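(* Let $D$ be a Dedekind domain (not a field) with quotient field $K$. The poset $\operatorname{Semistar}(D)$ of all semistar operations on $D$ is anti-isomorphic to the subposet $$(2^{\mathcal{Z}(\operatorname{Max}(D))})^\dagger = \left\{ (\mathcal{X}^{\preceq})^{\inf} : \mathcal{X} \in 2^{\mathcal{Z}(\operatorname{Max}(D))} \right\} = \left\{\mathcal{X} \in 2^{\mathcal{Z}(\operatorname{Max}(D))}: \mathcal{X}^{\preceq} \subseteq \mathcal{X} \text{ and } \mathcal{X}^{\inf} \subseteq \mathcal{X}\right\}$$ of $2^{\mathcal{Z}(\operatorname{Max}(D))}$. Explicitly, there is a poset anti-isomorphism $\operatorname{Semistar}(D) \to (2^{\mathcal{Z}(\operatorname{Max}(D))})^\dagger$ acting by $$\star \longmapsto \{(\mathfrak{p} \longmapsto -v_\mathfrak{p}(I)): I \in \mathcal{K}(D)^\star\}$$ with inverse acting by $$\mathcal{X} \longmapsto \bigwedge\left\{v\left(\bigcap_{\mathfrak{p} \in \operatorname{Max}(D)} \mathfrak{p}^{-f(\mathfrak{p})} D_\mathfrak{p} \right): f \in \mathcal{X}\right\}.$$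
   Context: Semistar operations: for an integral domain $D$ with quotient field $K$, $\mathcal{K}(D)$ is the lattice of all nonzero $D$-submodules of $K$ ordered by inclusion. A semistar operation on $D$ is a self-map $\star: I\mapsto I^\star$ of $\mathcal{K}(D)$ that is a closure operation (for all $I,J\in\mathcal{K}(D)$: $I\subseteq I^\star$; $I\subseteq J$ implies $I^\star\subseteq J^\star$; $(I^\star)^\star = I^\star$) and satisfies $I^\star J^\star \subseteq (IJ)^\star$ for all $I,J\in\mathcal{K}(D)$. We write $\mathcal{K}(D)^\star = \{I^\star: I \in \mathcal{K}(D)\}$. The set $\operatorname{Semistar}(D)$ is partially ordered by $\star_1 \leq \star_2$ iff $I^{\star_1}\subseteq I^{\star_2}$ for all $I\in\mathcal{K}(D)$; it is a complete lattice, with $I^{\bigwedge\Gamma} = \bigcap\{I^\star:\star\in\Gamma\}$. For $J\in\mathcal{K}(D)$, $v(J)$ is the semistar operation $I \mapsto I^{v(J)} = (J:_K(J:_K I))$, where $(A:_K B) = \{x\in K: xB\subseteq A\}$. Functions: $\mathbb{Z}[\infty] = \mathbb{Z}\cup\{\infty\}$ and $\mathbb{Z}[\pm\infty] = \mathbb{Z}\cup\{\pm\infty\}$ with their usual orders. For a set $S$, $\mathcal{Z}(S) = \{f: S \to \mathbb{Z}[\infty] : f^{-1}(\mathbb{Z}_{<0}) \text{ is finite}\}$. For $f,g \in \mathbb{Z}[\pm\infty]^S$ write $f\preceq g$ if $f(x)\leq g(x)$ for all but finitely many $x\in S$ and, for all $x\in S$, $f(x)=\infty$ if and only if $g(x)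 = \infty$. For $\mathcal{X}\subseteq\mathcal{Z}(S)$ put $\mathcal{X}^\preceq = \{g\in\mathcal{Z}(S): g\preceq f \text{ for some } f\in\mathcal{X}\}$ and $\mathcal{X}^{\inf} = \{\inf\mathcal{Y}: \mathcal{Y}\subseteq\mathcal{X} \text{ and } \inf\mathcal{Y}\in\mathcal{Z}(S)\}$, where infima are pointwise in $\mathbb{Z}[\pm\infty]^S$ and $\mathcal{Y}$ may be empty, with $\inf\emptyset$ the constant function $\infty$. Put $\mathcal{X}^\dagger = (\mathcal{X}^\preceq)^{\inf}$, and let $(2^{\mathcal{Z}(S)})^\dagger$ be the set of all $\mathcal{X}^\dagger$ with $\mathcal{X}\subseteq \mathcal{Z}(S)$, ordered by inclusion. Dedekind domains: $\operatorname{Max}(D)$ is the set of maximal ideals of $D$. For $\mathfrak{p}\in\operatorname{Max}(D)$ put $\mathfrak{p}^{\infty}D_\mathfrak{p} = (0)$ and $\mathfrak{p}^{-\infty}D_\mathfrak{p} = K$; for $I\in\mathcal{K}(D)$ define $v_\mathfrak{p}(I)\in\mathbb{Z}\cup\{\pm\infty\}$ by $ID_\mathfrak{p} = \mathfrak{p}^{v_\mathfrak{p}(I)}D_\mathfrak{p}$. *)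

(* Defs.v *)
From HB Require Import structures.
From mathcomp Require Import all_boot all_order all_algebra.
From mathcomp Require Import boolp classical_sets functions cardinality.
From mathcomp Require Import constructive_ereal.

Set Implicit Arguments.
Unset Strict Implicit.
Unset Printing Implicit Defensive.

Import Order.TTheory GRing.Theory Num.Theory.

Local Open Scope classical_set_scope.
Local Open Scope ring_scope.

Local Notation "x %:F" := (FracField.tofrac x) (format "x %:F").

(* Functions with values in Z[+-oo], represented by \bar int; Z[oo] is the
   part of \bar int that avoids -oo.  For f avoiding -oo, the preimage of the
   negative integers is [set x | f x < 0]. *)
Section Functions.
Variable S : Type.
Implicit Types (f g : S -> \bar int) (X Y : set (S -> \bar int)).

Definition zfun : set (S -> \bar int) :=
  [set f | (forall x, f x <> -oo%E) /\ finite_set [set x | (f x < 0)%E]].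

Definition preceq f g : Prop :=
  finite_set [set x | ~ (f x <= g x)%E] /\
  (forall x, f x = +oo%E <-> g x = +oo%E).

(* Infima are taken in Z[+-oo], so that inf set0 is +oo. *)
Definition pointwise_inf Y g : Prop :=
  forall x, infimums [set f x | f in Y] (g x).

Definition preceq_closure X : set (S -> \bar int) :=
  [set g | zfun g /\ exists2 f, X f & preceq g f].

Definition inf_closure X : set (S -> \bar int) :=
  [set g | zfun g /\ exists2 Y, Y `<=` X & pointwise_inf Y g].

Definition dagger X : set (S -> \bar int) := inf_closure (preceq_closure X).

Definition daggers : set (set (S -> \bar int)) :=
  [set dagger X | X in [set X | X `<=` zfun]].

End Functions.

Arguments zfun : clear implicits.
Arguments daggers : clear implicits.

Section Ideals.
Variable D : idomainType.
Implicit Types I p : set D.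

Definition is_ideal I : Prop :=
  [/\ I 0, forall x y, I x -> I y -> I (x + y)
         & forall a x, I x -> I (a * x)].

Definition fin_gen I : Prop :=
  exists (n : nat) (a : 'I_n -> D),
    I = [set x | exists c : 'I_n -> D, x = \sum_(i < n) c i * a i].

Definition prime_ideal p : Prop :=
  [/\ is_ideal p, ~ p 1 & forall x y, p (x * y) -> p x \/ p y].

Definition maximal_ideal p : Prop :=
  [/\ is_ideal p, ~ p 1
    & forall I, is_ideal I -> ~ I 1 -> p `<=` I -> I = p].

Record Max : Type := MaxIdeal {
  max_set :> set D;
  max_setP : maximal_ideal max_set }.

(* This definition admits fields. *)
Definition dedekind_domain : Prop :=
  [/\ forall I, is_ideal I -> fin_gen I,
      forall x : {fraction D}, integralOver (@FracField.tofrac D) x ->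
        exists a : D, x = a%:F
    & forall p, prime_ideal p -> p <> [set 0] -> maximal_ideal p].

End Ideals.

Section Modules.
Variable D : idomainType.
Notation K := {fraction D}.
Implicit Types A B : set K.

Definition submodule A : Prop :=
  [/\ A 0, forall x y, A x -> A y -> A (x + y)
         & forall (a : D) x, A x -> A (a%:F * x)].

Definition setprod A B : set K :=
  [set x | exists (n : nat) (a b : 'I_n -> K),
     [/\ forall i, A (a i), forall i, B (b i) & x = \sum_(i < n) a i * b i]].

Definition colon A B : set K := [set x | forall y, B y -> A (x * y)].

Definition base : set K := range (@FracField.tofrac D).

Record kmod : Type := KMod {
  kmod_set :> set K;
  kmod_submod : submodule kmod_set;
  kmod_neq0 : exists2 x, kmod_set x & x != 0 }.

Lemma kmod_inj (I J : kmod) : kmod_set I = kmod_set J -> I = J.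
Proof.
case: I J => [A sA nA] [B sB nB] /= eAB; case: _ / eAB in sB nB *.
by congr KMod; apply: Prop_irrelevance.
Qed.

Lemma kmod_super_neq0 (I : kmod) A :
  kmod_set I `<=` A -> exists2 x, A x & x != 0.
Proof. by case: I => I sI [x Ix x0] /= IA; exists x => //; apply: IA. Qed.

Lemma setprodM A B x y : A x -> B y -> setprod A B (x * y).
Proof.
move=> Ax By; exists 1%N, (fun=> x), (fun=> y).
by split => //; rewrite big_ord1.
Qed.

Lemma setprod_sub A B C : submodule C ->
  (forall x y, A x -> B y -> C (x * y)) -> setprod A B `<=` C.
Proof.
move=> [C0 CD _] ABC x [n [a [b [Aa Bb ->]]]].
by apply: big_ind => // i _; apply: ABC.
Qed.

Lemma setprod0 A B : setprod A B 0.
Proof. by exists 0%N, (fun=> 0), (fun=> 0); split; [case|case|rewrite big_ord0]. Qed.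

Lemma setprodD A B x y :
  setprod A B x -> setprod A B y -> setprod A B (x + y).
Proof.
move=> [n [a [b [Aa Bb ->]]]] [m [c [d [Ac Bd ->]]]].
exists (n + m)%N, (fun i : 'I_(n + m) =>
    match fintype.split i with inl j => a j | inr j => c j end),
  (fun i : 'I_(n + m) =>
    match fintype.split i with inl j => b j | inr j => d j end).
split=> [i|i|]; try by case: (fintype.split i).
rewrite big_split_ord /=; congr (_ + _); apply: eq_bigr => i _.
  by rewrite (unsplitK (inl i)).
by rewrite (unsplitK (inr i)).
Qed.

Lemma setprodZl A B (a : D) x : (forall y, A y -> A (a%:F * y)) ->
  setprod A B x -> setprod A B (a%:F * x).
Proof.
move=> AZ [n [c [d [Ac Bd ->]]]]; exists n, (fun i => a%:F * c i), d.
by split=> [i|//|]; [exact: AZ|rewrite mulr_sumr; under eq_bigr do rewrite mulrA].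
Qed.

Lemma submodule_setprod A B : submodule A -> submodule (setprod A B).
Proof.
move=> [A0 AD AZ]; split; [exact: setprod0|exact: setprodD|].
by move=> a x; apply: setprodZl => y; apply: AZ.
Qed.

Lemma submodule_colon A B : submodule A -> submodule (colon A B).
Proof.
move=> [A0 AD AZ]; split.
- by move=> y _; rewrite mul0r.
- by move=> x y Ax Ay z Bz; rewrite mulrDl; apply: AD; [apply: Ax|apply: Ay].
- by move=> a x Ax z Bz; rewrite -mulrA; apply/AZ/Ax.
Qed.

Lemma submodule_bigcap (T : Type) (P : set T) (F : T -> set K) :
  (forall i, P i -> submodule (F i)) -> submodule (\bigcap_(i in P) F i).
Proof.
move=> sF; split.
- by move=> i /sF[].
- by move=> x y Fx Fy i Pi; have [_ FD _] := sF i Pi; apply: FD; [apply: Fx|apply: Fy].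
- by move=> a x Fx i Pi; have [_ _ FZ] := sF i Pi; apply/FZ/Fx.
Qed.

Lemma submodule_base : submodule base.
Proof.
split.
- by exists 0 => //; rewrite tofrac0.
- by move=> _ _ [x _ <-] [y _ <-]; exists (x + y) => //; rewrite tofracD.
- by move=> a _ [x _ <-]; exists (a * x) => //; rewrite tofracM.
Qed.

Lemma kmul_neq0 (I J : kmod) : exists2 x, setprod I J x & x != 0.
Proof.
have [x Ix x0] := kmod_neq0 I; have [y Jy y0] := kmod_neq0 J.
by exists (x * y); [exact: setprodM|rewrite mulf_neq0].
Qed.

Definition kmul (I J : kmod) : kmod :=
  KMod (submodule_setprod _ (kmod_submod I)) (kmul_neq0 I J).

Implicit Types I J : kmod.

Record semistar : Type := Semistar {
  star_op :> kmod -> kmod;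
  star_ext : forall I : kmod, I `<=` star_op I;
  star_mono : forall I J : kmod, I `<=` J -> star_op I `<=` star_op J;
  star_idem : forall I : kmod, star_op (star_op I) = star_op I;
  star_mul : forall I J : kmod, setprod (star_op I) (star_op J) `<=` star_op (kmul I J) }.

Definition star_le (s t : semistar) : Prop := forall I : kmod, s I `<=` t I.

Lemma semistar_inj (s t : semistar) : (forall I, s I = t I) -> s = t.
Proof.
case: s t => [f f1 f2 f3 f4] [g g1 g2 g3 g4] /= /funext efg.
case: _ / efg in g1 g2 g3 g4 *.
by congr Semistar; apply: Prop_irrelevance.
Qed.

Lemma star_le_refl (s : semistar) : star_le s s.
Proof. by move=> I. Qed.

Lemma star_le_trans (s t u : semistar) :
  star_le s t -> star_le t u -> star_le s u.
Proof. by move=> st tu I x /st /tu. Qed.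

Lemma star_le_anti (s t : semistar) : star_le s t -> star_le t s -> s = t.
Proof.
by move=> st ts; apply: semistar_inj => I; apply/kmod_inj/seteqP; split.
Qed.

Section DivisorialClosure.
Variable J : kmod.

Definition vset A : set K := colon J (colon J A).

Lemma vset_ext A : A `<=` vset A.
Proof. by move=> x Ax y; rewrite mulrC; apply. Qed.

Lemma vset_mono A B : A `<=` B -> vset A `<=` vset B.
Proof. by move=> AB x vx y By; apply: vx => z /AB; apply: By. Qed.

Lemma vset_idem A : vset (vset A) = vset A.
Proof.
apply/seteqP; split; last exact: vset_ext.
by move=> x vx y Jy; apply: vx => z; rewrite mulrC; apply.
Qed.

Lemma vset_mul A B : setprod (vset A) (vset B) `<=` vset (setprod A B).
Proof.
apply: setprod_sub; first exact/submodule_colon/kmod_submod.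
move=> x y vx vy z Jz; rewrite -mulrA; apply: vx => a Aa.
rewrite -mulrA; apply: vy => b Bb.
by rewrite -mulrA; apply/Jz/setprodM.
Qed.

Definition vmod (I : kmod) : kmod :=
  KMod (submodule_colon (colon J I) (kmod_submod J))
       (kmod_super_neq0 (@vset_ext I)).

Lemma vmod_idem I : vmod (vmod I) = vmod I.
Proof. exact/kmod_inj/vset_idem. Qed.

Definition vstar : semistar :=
  @Semistar vmod (fun I => @vset_ext I) (fun I I' => @vset_mono I I')
    vmod_idem (fun I I' => @vset_mul I I').

End DivisorialClosure.

Section Meet.
Variable G : set semistar.

Definition meet_set (I : kmod) : set K := \bigcap_(s in G) (s I : set K).

Lemma meet_ext I : I `<=` meet_set I.
Proof. by move=> x Ix s _; apply: star_ext. Qed.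

Lemma meet_submodule (I : kmod) : submodule (meet_set I).
Proof. by apply: submodule_bigcap => s _; apply: kmod_submod. Qed.

Definition meet_mod (I : kmod) : kmod :=
  KMod (meet_submodule I) (kmod_super_neq0 (@meet_ext I)).

Lemma meet_mono I J : I `<=` J -> meet_mod I `<=` meet_mod J.
Proof. by move=> IJ x mx s Gs; apply: (star_mono IJ); apply: mx. Qed.

Lemma meet_idem I : meet_mod (meet_mod I) = meet_mod I.
Proof.
apply/kmod_inj/seteqP; split; last exact: meet_ext.
move=> x mx s Gs; rewrite -star_idem.
by apply: (star_mono (I := meet_mod I)); [move=> y; apply|apply: mx].
Qed.

Lemma meet_mul I J :
  setprod (meet_mod I) (meet_mod J) `<=` meet_mod (kmul I J).
Proof.
apply: setprod_sub; first exact: kmod_submod.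
move=> x y mx my s Gs; apply: star_mul.
by apply: setprodM; [apply: mx|apply: my].
Qed.

Definition star_meet : semistar :=
  @Semistar meet_mod meet_ext meet_mono meet_idem meet_mul.

Lemma star_meet_glb (t : semistar) :
  star_le t star_meet <-> forall s, G s -> star_le t s.
Proof.
split=> [tm s Gs I x tx|tG I x tx s Gs]; last exact: tG.
exact: (tm I x tx s Gs).
Qed.

End Meet.

Definition localization (p : Max D) : set K :=
  [set x | exists a s : D, ~ max_set p s /\ x = a%:F / s%:F].

Fixpoint ideal_pow (I : set D) (n : nat) : set K :=
  if n is m.+1 then setprod [set a%:F | a in I] (ideal_pow I m) else base.

(* [prime_pow_loc p n] is p^n D_p; for n < 0, the fractional ideal p^n of D is
   the inverse (D :_K p^(-n)) of p^(-n). *)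
Definition prime_pow_loc (p : Max D) (n : \bar int) : set K :=
  match n with
  | EFin (Posz k) => setprod (ideal_pow p k) (localization p)
  | EFin (Negz k) => setprod (colon base (ideal_pow p k.+1)) (localization p)
  | EPInf => [set 0]
  | ENInf => setT
  end.

(* The n such that I D_p = p^n D_p, which exists and is unique when D is a
   Dedekind domain that is not a field; 0 is a junk value. *)
Definition vp (p : Max D) (I : kmod) : \bar int :=
  xget 0%E [set n | setprod I (localization p) = prime_pow_loc p n].

Definition loc_inter (f : Max D -> \bar int) : set K :=
  \bigcap_(p in [set: Max D]) prime_pow_loc p (- f p)%E.

Lemma max_ideal_neq0 (p : Max D) : ~ GRing.field_axiom D ->
  exists2 x, max_set p x & x != 0.
Proof.
move=> Dnf; apply: contrapT => p0; apply: Dnf => x x0.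
apply: contrapT => xU.
have [pI p1 pmax] := max_setP p; have [p00 _ _] := pI.
have pE y : max_set p y -> y = 0.
  by move=> py; apply/eqP; apply: contrapT => /negP y0; apply: p0; exists y.
pose I : set D := [set y | exists a, y = a * x].
have Ip : I = p.
  apply: pmax.
  - split; first by exists 0; rewrite mul0r.
    + by move=> _ _ [a ->] [b ->]; exists (a + b); rewrite mulrDl.
    + by move=> a _ [b ->]; exists (a * b); rewrite mulrA.
  - by move=> [a ax]; apply: xU; apply/unitrPr; exists a; rewrite mulrC.
  - by move=> y /pE ->; exists 0; rewrite mul0r.
have : max_set p x by rewrite -Ip; exists 1; rewrite mul1r.
by move=> /pE xE; rewrite xE eqxx in x0.
Qed.

Lemma ideal_pow_base (I : set D) n x : is_ideal I -> ideal_pow I n x -> base x.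
Proof.
move=> sI; elim: n x => [//|n IH] x /=; apply: setprod_sub.
  exact: submodule_base.
move=> _ y [a Ia <-] /IH; have [_ _] := submodule_base; exact.
Qed.

Lemma ideal_powX (I : set D) n x : I x -> ideal_pow I n (x ^+ n)%:F.
Proof.
move=> Ix; elim: n => [|n IH] /=; first by exists 1.
by rewrite exprS tofracM; apply: setprodM => //; exists x.
Qed.

Lemma localization_base (p : Max D) (a : D) : localization p a%:F.
Proof.
exists a, 1; split; first by case: (max_setP p).
by rewrite tofrac1 divr1.
Qed.

Lemma submodule_ideal_pow (I : set D) n : is_ideal I -> submodule (ideal_pow I n).
Proof.
move=> [I0 ID IZ]; case: n => [|n] /=; first exact: submodule_base.
apply: submodule_setprod; split.
- by exists 0 => //; rewrite tofrac0.
- by move=> _ _ [a Ia <-] [b Ib <-]; exists (a + b); rewrite ?tofracD//; apply: ID.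
- by move=> a _ [b Ib <-]; exists (a * b); rewrite ?tofracM//; apply: IZ.
Qed.

Lemma submodule_prime_pow_loc (p : Max D) n : submodule (prime_pow_loc p n).
Proof.
have [pI _ _] := max_setP p.
case: n => [[k|k]| |] /=; rewrite ?/prime_pow_loc.
- exact/submodule_setprod/submodule_ideal_pow.
- exact/submodule_setprod/submodule_colon/submodule_base.
- by split=> [//|x y -> ->|a x ->]; rewrite ?addr0 ?mulr0.
- by [].
Qed.

Lemma loc_inter_neq0 (Dnf : ~ GRing.field_axiom D) (f : Max D -> \bar int) :
  zfun _ f -> exists2 x, loc_inter f x & x != 0.
Proof.
move=> [fNy fneg].
pose T := {classic Max D}.
pose deg (p : Max D) : nat := if f p is EFin (Negz k) then k.+1 else 0.
move: fneg => /(@finite_seqP T) [s sE].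
pose a (p : Max D) : D := sval (cid2 (max_ideal_neq0 p Dnf)).
have aP p : max_set p (a p) by rewrite /a; case: cid2.
have a0 p : a p != 0 by rewrite /a; case: cid2.
exists (\prod_(p <- s) a p ^+ deg p)%:F; last first.
  rewrite tofrac_eq0; elim/big_ind: _ => [|x y x0 y0|p _].
  - exact: oner_neq0.
  - exact: mulf_neq0.
  - exact: expf_neq0.
move=> p _; set x := \prod_(_ <- _) _.
have [pI _ _] := max_setP p.
case fp: (f p) => [[[|k]|k]| |] //.
- rewrite /prime_pow_loc /= -[x%:F]mul1r.
  by apply: setprodM; [exists 1|exact: localization_base].
- rewrite /prime_pow_loc /= -[x%:F]mul1r.
  apply: setprodM; last exact: localization_base.
  by move=> y; rewrite mul1r; exact: (@ideal_pow_base _ k.+1).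
- have ps : (p : T) \in s.
    have : [set x | (f x < 0)%E] p by rewrite /= fp.
    by rewrite sE.
  have [b ->] : exists b, x = a p ^+ k.+1 * b.
    rewrite /x (big_rem (p : T)) //=; eexists; congr (_ * _).
    by rewrite /deg fp.
  rewrite /prime_pow_loc /= tofracM.
  by apply: setprodM; [exact: (@ideal_powX _ k.+1)|exact: localization_base].
- by have := fNy p; rewrite fp.
Qed.

Definition loc_inter_mod (Dnf : ~ GRing.field_axiom D) (f : Max D -> \bar int)
    (fZ : zfun _ f) : kmod :=
  KMod (submodule_bigcap (fun p _ => submodule_prime_pow_loc p (- f p)%E))
       (loc_inter_neq0 Dnf fZ).

Definition semistar_to_fun (s : semistar) : set (Max D -> \bar int) :=
  [set (fun p => - vp p I)%E | I in range s].

Definition fun_to_semistar (Dnf : ~ GRing.field_axiom D)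
    (X : set (Max D -> \bar int)) : semistar :=
  star_meet [set s | exists (f : Max D -> \bar int) (fZ : zfun _ f),
                       X f /\ s = vstar (loc_inter_mod Dnf fZ)].

End Modules.

(* G is the inverse of the anti-isomorphism F from T onto B, a subset of U. *)
Definition anti_isomorphism (T U : Type) (leT : T -> T -> Prop)
    (leU : U -> U -> Prop) (B : set U) (F : T -> U) (G : U -> T) : Prop :=
  [/\ forall x, B (F x),
      forall x y, leT x y <-> leU (F y) (F x),
      forall x, G (F x) = x
    & forall u, B u -> F (G u) = u].

(* Main.v *)
(* In a Dedekind domain every maximal ideal p carries a discrete valuation whose
   "at least n" sets are the modules p^n D_p. Hence I |-> -v(I) is an order
   isomorphism from the nonzero submodules of K onto zfun, which turns
   intersections into pointwise infima and colons (J : H) into differences of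
   exponents. A family of nonzero submodules is the set of fixed points of a
   semistar operation iff it is stable under intersections and under colons; on
   exponents these are the closures under inf and under preceq, because g
   precedes f iff g = f - h for some h in zfun, with oo - h = oo.

   The existence of the valuation rests on one element z of K with z p `<=` D and
   z c a unit at p for some c in p; then 1/z is a uniformizer. *)
Require Import Defs.
From mathcomp Require Import all_boot all_order all_algebra.
From mathcomp Require Import boolp classical_sets functions cardinality.
From mathcomp Require Import constructive_ereal.
From mathcomp Require Import zify ring.

Set Implicit Arguments.
Unset Strict Implicit.
Unset Printing Implicit Defensive.

Import Order.TTheory GRing.Theory Num.Theory.

Local Open Scope classical_set_scope.
Local Open Scope ring_scope.

Local Notation "x %:F" := (FracField.tofrac x) (format "x %:F").

(** * Ideals of a noetherian domain *)

Section Noetherian.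
Variable D : idomainType.
Hypothesis noeth : forall I : set D, is_ideal I -> fin_gen I.

(** Without a maximal member, dependent choice yields a strictly increasing chain in [F]. The
    generators of its union all lie in one term, which then contains the next one. *)
Lemma noetherian_maximal (F : set (set D)) :
  (forall I, F I -> is_ideal I) -> F !=set0 ->
  exists2 I, F I & forall J, F J -> I `<=` J -> J = I.
Proof.
move=> Fid [I0 FI0]; apply: contrapT => nomax.
pose T := {I : set D | F I}.
have next (I : T) : {J : T | proj1_sig I `<` proj1_sig J}.
  apply: cid; case: I => I FI /=; apply: contrapT => noJ; apply: nomax.
  exists I => // J FJ IJ; apply: contrapT => JI; apply: noJ.
  by exists (exist _ J FJ); split=> // JI'; apply: JI; apply/seteqP.
have [A [_ AS]] := dependent_choice next (exist _ I0 FI0).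
pose B n := proj1_sig (A n).
have BI n : is_ideal (B n) by apply: Fid; exact: proj2_sig.
have Bmono m n : (m <= n)%N -> B m `<=` B n.
  by move=> /subnK <-; elim: (n - m)%N => [|k IH] //; apply: subset_trans IH (AS _).1.
have UI : is_ideal (\bigcup_n B n).
  split; first by exists 0%N => //; case: (BI 0%N).
  - move=> x y [m _ Bx] [n _ By]; exists (maxn m n) => //.
    have [_ BD _] := BI (maxn m n).
    by apply: BD; [apply: Bmono Bx; exact: leq_maxl|apply: Bmono By; exact: leq_maxr].
  - by move=> a x [n _ Bx]; exists n => //; have [_ _] := BI n; apply.
have [n [a aE]] := noeth UI.
have Ba i : exists k, B k (a i).
  have : (\bigcup_n B n) (a i).
    rewrite aE; exists (fun j => (i == j)%:R).
    rewrite (bigD1 i) //= eqxx mul1r big1 ?addr0 // => j.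
    by rewrite eq_sym => /negbTE ->; rewrite mul0r.
  by case=> k _; exists k.
have [k kP] := choice Ba.
pose K := \max_i k i.
apply: (AS K).2 => x Bx.
have : (\bigcup_n B n) x by exists K.+1.
rewrite aE => -[c ->]; have [B0 BD BZ] := BI K.
apply: (big_ind (B K)) => // i _; apply: BZ.
by apply: Bmono (kP i); exact: leq_bigmax.
Qed.

Lemma ideal_in_Max (I : set D) : is_ideal I -> ~ I 1 ->
  exists p : Max D, I `<=` p.
Proof.
move=> II I1.
have [||p [pI p1 Ip] pmax] :=
    @noetherian_maximal [set J | [/\ is_ideal J, ~ J 1 & I `<=` J]].
- by move=> J [].
- by exists I; split.
- suff pM : maximal_ideal p by exists (MaxIdeal pM).
  by split=> // J JI J1 pJ; apply: pmax => //; split=> //; apply: subset_trans pJ.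
Qed.

Definition adjoin (I : set D) (x : D) : set D :=
  [set y | exists2 i, I i & exists a, y = i + a * x].

Lemma is_ideal_adjoin I x : is_ideal I -> is_ideal (adjoin I x).
Proof.
move=> [I0 ID IZ]; split.
- by exists 0 => //; exists 0; rewrite mul0r addr0.
- move=> _ _ [i Ii [a ->]] [j Ij [b ->]]; exists (i + j); first exact: ID.
  by exists (a + b); rewrite mulrDl addrACA.
- move=> c _ [i Ii [a ->]]; exists (c * i); first exact: IZ.
  by exists (c * a); rewrite mulrDr mulrA.
Qed.

Lemma sub_adjoin I x : I `<=` adjoin I x.
Proof. by move=> i Ii; exists i => //; exists 0; rewrite mul0r addr0. Qed.

Lemma mem_adjoin (I : set D) x : is_ideal I -> adjoin I x x.
Proof. by case=> I0 _ _; exists 0 => //; exists 1; rewrite mul1r add0r. Qed.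

End Noetherian.

(** * Maximal ideals and their complements *)

Section Max.
Variable D : idomainType.
Implicit Types p q : Max D.

Lemma Max_inj p q : max_set p = max_set q -> p = q.
Proof.
case: p q => [p pM] [q qM] /= epq; case: _ / epq in qM *.
by congr MaxIdeal; apply: Prop_irrelevance.
Qed.

Lemma Max_sub p q : p `<=` q -> p = q.
Proof.
move=> pq; apply: Max_inj; have [_ _ pmax] := max_setP p.
by have [qI q1 _] := max_setP q; rewrite (pmax q).
Qed.

Lemma Max_sep p q : p <> q -> exists2 s, max_set q s & ~ max_set p s.
Proof.
move=> pq; apply: contrapT => h; apply: pq; apply/esym/Max_sub => s qs.
by apply: contrapT => ps; apply: h; exists s.
Qed.

(** If [x] is outside [p], then [1 = i + a * x] with [i] in [p]; multiplying by [y] puts [y] in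
    [p]. *)
Lemma Max_prime p : prime_ideal (max_set p).
Proof.
have [pI p1 pmax] := max_setP p; split=> // x y pxy.
apply: contrapT => /not_orP[px py].
have xI : adjoin p x = p \/ adjoin p x 1.
  have [h|h] := pselect (adjoin p x 1); [by right|left].
  by apply: pmax => //; [exact: is_ideal_adjoin|exact: sub_adjoin].
have [_ pD pZ] := pI.
case: xI => [xI|[i pi [a e1]]]; first by apply: px; rewrite -xI; apply: mem_adjoin.
apply: py; rewrite -[y]mul1r e1 mulrDl -mulrA.
by apply: pD; [rewrite mulrC|]; apply: pZ.
Qed.

Lemma Max0 p : max_set p 0.
Proof. by case: (max_setP p) => [[]]. Qed.

Lemma Max1 p : ~ max_set p 1.
Proof. by case: (max_setP p). Qed.

Lemma MaxMr p a x : max_set p x -> max_set p (a * x).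
Proof. by case: (max_setP p) => [[_ _ h] _ _]; apply: h. Qed.

Lemma MaxMl p a x : max_set p x -> max_set p (x * a).
Proof. by rewrite mulrC; apply: MaxMr. Qed.

Lemma Max_notM p x y : ~ max_set p x -> ~ max_set p y -> ~ max_set p (x * y).
Proof. by move=> px py; case: (Max_prime p) => _ _ h /h []. Qed.

Lemma Max_notX p x n : ~ max_set p x -> ~ max_set p (x ^+ n).
Proof.
move=> px; elim: n => [|n IH]; first exact: Max1.
by rewrite exprS; apply: Max_notM.
Qed.

Lemma Max_not_neq0 p x : ~ max_set p x -> x != 0.
Proof. by move=> px; apply: contra_notN px => /eqP ->; apply: Max0. Qed.

End Max.

Lemma fracP (D : idomainType) (x : {fraction D}) :
  exists2 a, exists2 b, b != 0 & x = a%:F / b%:F & (x != 0 -> a != 0).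
Proof.
have [a [b b0 xE]] : exists a, exists2 b, b != 0 & x = a%:F / b%:F.
  elim/quotW: x => f; exists (frac f).1, (frac f).2; first exact: denom_ratioP.
  apply: (@mulIf _ (frac f).2%:F); first by rewrite tofrac_eq0 denom_ratioP.
  rewrite divfK ?tofrac_eq0 ?denom_ratioP //.
  (* On representatives the equation is a cross multiplication. *)
  unlock FracField.tofrac; rewrite -[LHS]FracField.pi_mul.
  apply/eqmodP; rewrite /= FracField.equivfE /FracField.mulf.
  rewrite !numden_Ratio ?oner_neq0 ?mulf_neq0 ?oner_neq0 ?denom_ratioP //.
  by rewrite !mulr1 mulrC.
exists a; first by exists b.
by apply: contra_neq => a0; rewrite xE a0 tofrac0 mul0r.
Qed.

(** * Local invertibility of maximal ideals *)

Section Dedekind.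
Variable D : idomainType.
Hypothesis hD : dedekind_domain D.
Hypothesis Dnf : ~ GRing.field_axiom D.
Notation K := {fraction D}.
Implicit Types p q : Max D.

Lemma dedekind_noetherian (I : set D) : is_ideal I -> fin_gen I.
Proof. by case: hD => h _ _; apply: h. Qed.

(* Cayley-Hamilton for the multiplication by z on the finitely generated I. *)
Lemma stable_ideal_integral (I : set D) (z : K) : is_ideal I ->
  (exists2 x, I x & x != 0) ->
  (forall x, I x -> exists2 y, I y & z * x%:F = y%:F) ->
  exists a : D, z = a%:F.
Proof.
move=> II [x Ix x0] zI; case: hD => _ + _; apply.
have [n [a aE]] := dedekind_noetherian II.
have Ia i : I (a i).
  rewrite aE; exists (fun j => (i == j)%:R).
  rewrite (bigD1 i) //= eqxx mul1r big1 ?addr0 // => j.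
  by rewrite eq_sym => /negbTE ->; rewrite mul0r.
have zc i : exists c : 'I_n -> D, z * (a i)%:F = (\sum_j c j * a j)%:F.
  have [y Iy zy] := zI _ (Ia i).
  by move: Iy; rewrite aE => -[c yE]; exists c; rewrite zy yE.
have [c cE] := choice zc.
(* Transposed, so that the row of generators is a left eigenvector for the eigenvalue [z]. *)
pose M : 'M[D]_n := \matrix_(j, i) c i j.
exists (char_poly M); first exact: char_poly_monic.
rewrite map_char_poly -eigenvalue_root_char.
apply/eigenvalueP; exists (\row_i (a i)%:F).
  apply/rowP => i; rewrite !mxE cE rmorph_sum /=; apply: eq_bigr => j _.
  by rewrite !mxE tofracM mulrC.
apply: contra_neq x0 => /rowP a0; move: Ix; rewrite aE => -[d ->].
rewrite big1 // => i _; have := a0 i; rewrite !mxE => /eqP.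
by rewrite tofrac_eq0 => /eqP ->; rewrite mulr0.
Qed.

(* Writing p = (aD : b) for a maximal ideal of the form (aD : b) inside p, the
   fraction z = b / a satisfies z p `<=` D; integral closedness excludes
   z p `<=` p. *)
Lemma local_inverse p : exists z : K,
  (forall c, max_set p c -> exists d, z * c%:F = d%:F) /\
  exists2 c, max_set p c & exists2 u, ~ max_set p u & z * c%:F = u%:F.
Proof.
have [a pa a0] := max_ideal_neq0 p Dnf.
pose col (b : D) : set D := [set c | exists d, c * b = d * a].
have colI b : is_ideal (col b).
  split; first by exists 0; rewrite !mul0r.
  - by move=> x y [d e] [d' e']; exists (d + d'); rewrite !mulrDl e e'.
  - by move=> c x [d e]; exists (c * d); rewrite -!mulrA e.
have [||I [b -> bp] bmax] :=
  noetherian_maximal dedekind_noetherian (F := [set I | exists2 b, I = col b & I `<=` p]).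
- by move=> I [b ->].
- exists (col 1); exists 1 => // c [d]; rewrite mulr1 => ->; exact: MaxMr.
have colM c : col b `<=` col (c * b).
  by move=> x [d e]; exists (c * d); rewrite -mulrA -e mulrCA.
have bE c : col (c * b) `<=` p -> col (c * b) = col b.
  by move=> cp; apply: bmax; [exists (c * b)|exact: colM].
have colp : col b = p.
  have aI : col b a by exists b; rewrite mulrC.
  have : prime_ideal (col b).
    split=> // [/bp/Max1 //|x y [d e]].
    apply: contrapT => /not_orP[xb yb].
    have [|xbp] := pselect (col (x * b) `<=` p).
      by move=> /bE cE; apply: yb; rewrite -cE; exists d; rewrite -e; ring.
    (* Some [s] outside [p] carries [x * b] into [aD]. Primality of [p] keeps [col (s * b)] inside
       [p], so it equals [col b] by maximality, and it contains [x]. *)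
    have [s [t st] ps] : exists2 s, col (x * b) s & ~ max_set p s.
      apply: contrapT => h; apply: xbp => s sx; apply: contrapT => ps.
      by apply: h; exists s.
    have sp : col (s * b) `<=` p.
      move=> c [d' e']; apply: contrapT => pc.
      apply: (Max_notM pc ps); apply: bp.
      by exists d'; rewrite -mulrA e'.
    apply: xb; rewrite -(bE _ sp).
    by exists t; rewrite -st; ring.
  case: hD => _ _ /[apply] -[|_ _].
    by move=> col0; move: aI a0; rewrite col0 /= => ->; rewrite eqxx.
  by move=> cmax; have [pI p1 _] := max_setP p; rewrite (cmax p).
have aF0 : a%:F != 0 by rewrite tofrac_eq0.
exists (b%:F / a%:F).
have zp c : max_set p c -> exists d, b%:F / a%:F * c%:F = d%:F.
  rewrite -colp => -[d e]; exists d; rewrite mulrAC -tofracM.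
  by rewrite [b * c]mulrC e tofracM mulfK.
split=> //; apply: contrapT => h.
(* Otherwise [z p] lies in [p], so [b / a] is some [d] in [D] and 1 lies in [col b = p]. *)
have [|||d dE] := @stable_ideal_integral p (b%:F / a%:F).
- by case: (max_setP p).
- by exists a.
- move=> c pc; have [d dE] := zp _ pc; exists d => //.
  by apply: contrapT => pd; apply: h; exists c => //; exists d.
apply: (@Max1 _ p); rewrite -colp; exists d; apply/eqP; rewrite mul1r.
by rewrite -tofrac_eq tofracM -dE divfK.
Qed.

End Dedekind.

(** * The local ring at [p] and its units *)

Section Localization.
Variables (D : idomainType) (p : Max D).
Notation K := {fraction D}.
Notation loc := (localization p).

Lemma locM x y : loc x -> loc y -> loc (x * y).
Proof.
move=> [a [s [ps ->]]] [b [t [pt ->]]]; exists (a * b), (s * t).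
by split; [exact: Max_notM|rewrite mulf_div !tofracM].
Qed.

Lemma locD x y : loc x -> loc y -> loc (x + y).
Proof.
move=> [a [s [ps ->]]] [b [t [pt ->]]]; exists (a * t + b * s), (s * t).
split; first exact: Max_notM.
by rewrite addf_div ?tofrac_eq0 ?(Max_not_neq0 ps) ?(Max_not_neq0 pt)// tofracD !tofracM.
Qed.

Lemma loc1 : loc 1.
Proof. by rewrite -tofrac1; apply: localization_base. Qed.

Lemma locV s : ~ max_set p s -> loc s%:F^-1.
Proof. by move=> ps; exists 1, s; rewrite tofrac1 div1r. Qed.

Lemma locX x n : loc x -> loc (x ^+ n).
Proof.
by move=> lx; elim: n => [|n IH]; [exact: loc1|rewrite exprS; apply: locM].
Qed.

Definition loc_unit : set K :=
  [set x | exists a s, [/\ ~ max_set p a, ~ max_set p s & x = a%:F / s%:F]].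

Lemma loc_unit_loc x : loc_unit x -> loc x.
Proof. by case=> a [s [_ ps ->]]; exists a, s. Qed.

Lemma loc_unitM x y : loc_unit x -> loc_unit y -> loc_unit (x * y).
Proof.
move=> [a [s [pa ps ->]]] [b [t [pb pt ->]]]; exists (a * b), (s * t).
by split; [exact: Max_notM|exact: Max_notM|rewrite mulf_div !tofracM].
Qed.

Lemma loc_unitV x : loc_unit x -> loc_unit x^-1.
Proof. by move=> [a [s [pa ps ->]]]; exists s, a; rewrite invf_div. Qed.

Lemma loc_unit_base a : ~ max_set p a -> loc_unit a%:F.
Proof.
by move=> pa; exists a, 1; split=> //; [exact: Max1|rewrite tofrac1 divr1].
Qed.

Lemma loc_unit_neq0 x : loc_unit x -> x != 0.
Proof.
move=> [a [s [pa ps ->]]]; rewrite mulf_neq0 ?invr_eq0 ?tofrac_eq0 //.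
  exact: Max_not_neq0 pa.
exact: Max_not_neq0 ps.
Qed.

End Localization.

(** * The discrete valuation at [p] *)

Section Valuation.
Variable D : idomainType.
Hypothesis hD : dedekind_domain D.
Hypothesis Dnf : ~ GRing.field_axiom D.
Notation K := {fraction D}.
Implicit Types (p q : Max D) (x y : K).

Definition unif p : K := (proj1_sig (cid (local_inverse hD Dnf p)))^-1.

Lemma unifV_base p c : max_set p c -> exists d, (unif p)^-1 * c%:F = d%:F.
Proof. by rewrite /unif invrK; case: cid => z /= [+ _]; apply. Qed.

Lemma unif_spec p :
  exists2 c, max_set p c & exists2 u, ~ max_set p u & unif p * u%:F = c%:F.
Proof.
rewrite /unif; case: cid => z /= [_ [c pc [u pu zc]]].
exists c => //; exists u => //; rewrite -zc mulKf //.
apply: contra_notN (pu) => /eqP z0; have -> : u = 0; last exact: Max0.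
by apply/eqP; rewrite -tofrac_eq0 -zc z0 mul0r.
Qed.

Lemma unif_neq0 p : unif p != 0.
Proof.
rewrite /unif invr_eq0; case: cid => z /= [_ [c pc [u pu zc]]].
apply: contra_notN (pu) => /eqP z0; have -> : u = 0; last exact: Max0.
by apply/eqP; rewrite -tofrac_eq0 -zc z0 mul0r.
Qed.

Hint Resolve unif_neq0 : core.

Lemma loc_unif p : localization p (unif p).
Proof.
have [c _ [u pu e]] := unif_spec p; exists c, u; split=> //.
by rewrite -e mulfK // tofrac_eq0 (Max_not_neq0 pu).
Qed.

Lemma Max_unif p c : max_set p c -> exists d, c%:F = unif p * d%:F.
Proof. by move=> /unifV_base[d e]; exists d; rewrite -e mulVKf. Qed.

(** Clearing denominators gives [b * u * s = c * a * v]: the right side lies in [p] with [c], while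
    the left side is a product of elements outside [p]. *)
Lemma unif_nunit p t : localization p t -> ~ loc_unit p (unif p * t).
Proof.
have [c pc [u pu e]] := unif_spec p.
move=> [a [s [ps ->]]] [b [v [pb pv]]] e'.
apply: (Max_notM (Max_notM pb pu) ps).
suff -> : b * u * s = c * a * v by do 2!apply: MaxMl.
have s0 : s%:F != 0 by rewrite tofrac_eq0 (Max_not_neq0 ps).
have v0 : v%:F != 0 by rewrite tofrac_eq0 (Max_not_neq0 pv).
apply/eqP; rewrite -tofrac_eq !tofracM -e.
have -> : b%:F = unif p * (a%:F / s%:F) * v%:F by rewrite e' divfK.
have cancel_s (F : fieldType) (x y z w r : F) :
  r != 0 -> x * (y / r) * z * w * r = x * w * y * z by move=> r0; field.
by apply/eqP/cancel_s.
Qed.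

Lemma base_unit_or_unif p c :
  loc_unit p c%:F \/ exists d, c%:F = unif p * d%:F.
Proof.
have [/Max_unif|/loc_unit_base] := pselect (max_set p c); by [right|left].
Qed.

(** Among the nonzero elements without a factorization, take [d] with [J d] maximal. Then [d] is not
    a unit, so [d = unif p * e], where [e] has no factorization either; maximality gives
    [J e = J d], which makes [unif p] a unit. *)
Lemma base_factor p (c : D) : c != 0 ->
  exists n : nat, exists2 y, loc_unit p y & c%:F = unif p ^+ n * y.
Proof.
move=> c0; apply: contrapT => bad0.
pose bad (c : D) := ~ exists n : nat, exists2 y, loc_unit p y & c%:F = unif p ^+ n * y.
(* The contraction to [D] of the principal ideal of the local ring, so that the noetherian property
   of [D] itself applies. *)
pose J (c : D) : set D := [set x | exists2 t, localization p t & x%:F = t * c%:F].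
have JI d : is_ideal (J d).
  split; first by exists 0%:F; [exact: localization_base|rewrite tofrac0 mul0r].
  - move=> x y [t lt ex] [t' lt' ey]; exists (t + t'); first exact: locD.
    by rewrite tofracD ex ey mulrDl.
  - move=> a x [t lt ex]; exists (a%:F * t).
      by apply: locM => //; apply: localization_base.
    by rewrite tofracM ex mulrA.
have [||I [d [d0 bd ->]] Imax] := noetherian_maximal (dedekind_noetherian hD)
    (F := [set I | exists d, [/\ d != 0, bad d & I = J d]]).
- by move=> I [d [_ _ ->]].
- by exists (J c), c.
have [du|[e de]] := base_unit_or_unif p d.
  by apply: bd; exists 0%N, d%:F => //; rewrite mul1r.
have e0 : e != 0.
  by rewrite -tofrac_eq0; move: d0; rewrite -tofrac_eq0 de mulf_eq0 negb_or => /andP[].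
have Je : J e = J d.
  apply: Imax.
    exists e; split=> // -[n [y uy ey]]; apply: bd; exists n.+1, y => //.
    by rewrite de ey mulrA exprS.
  move=> x [t lt ex]; exists (t * unif p); first exact: locM lt (loc_unif p).
  by rewrite ex de mulrA.
have : J e e by exists 1; [exact: loc1|rewrite mul1r].
rewrite Je => -[t lt]; rewrite de => e1.
apply: (unif_nunit lt); rewrite -[unif p * t]divr1 -tofrac1.
have -> : unif p * t = 1.
  apply: (@mulIf _ e%:F); first by rewrite tofrac_eq0.
  by rewrite mul1r {2}e1; ring.
by rewrite tofrac1 divr1 -tofrac1; apply: loc_unit_base; exact: Max1.
Qed.

Definition has_val p x (n : int) : Prop :=
  exists2 y, loc_unit p y & x = unif p ^ n * y.

Lemma has_val_exists p x : x != 0 -> exists n, has_val p x n.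
Proof.
have [a [b b0 xE] a0] := fracP x => /a0 {}a0.
have [n [y uy ay]] := base_factor p a0; have [m [z uz bz]] := base_factor p b0.
exists (n%:Z - m%:Z), (y / z); first exact/loc_unitM/loc_unitV.
rewrite expfzDr // -invr_expz xE ay bz invfM mulrACA; congr (_ * _).
Qed.

Lemma loc_unifX p (n : int) : 0 <= n -> localization p (unif p ^ n).
Proof. by case: n => // n _; apply/locX/loc_unif. Qed.

(** If [n < m], cancelling [unif p ^ n] exhibits the unit [y] as [unif p] times an element of the
    local ring, against [unif_nunit]. *)
Lemma has_val_ge p x n m : has_val p x n ->
  (exists2 t, localization p t & x = unif p ^ m * t) <-> m <= n.
Proof.
move=> [y uy xE]; split=> [[t lt xE']|mn]; last first.
  exists (unif p ^ (n - m) * y); last by rewrite mulrA -expfzDr // subrKC.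
  by apply: locM; [apply: loc_unifX; rewrite subr_ge0|exact: loc_unit_loc].
rewrite leNgt; apply/negP => nm.
have lt' : localization p (unif p ^ (m - n - 1) * t).
  by apply: locM => //; apply: loc_unifX; lia.
apply: (unif_nunit lt'); rewrite mulrA -{1}[unif p]expr1z -expfzDr //.
have -> : 1 + (m - n - 1) = - n + m by lia.
by rewrite expfzDr // -mulrA -xE' xE -invr_expz mulKf // expfz_neq0.
Qed.

Lemma has_val_inj p x n m : has_val p x n -> has_val p x m -> n = m.
Proof.
have aux k l : has_val p x k -> has_val p x l -> k <= l.
  move=> [y uy xE] hl; apply/(has_val_ge k hl); exists y => //.
  exact: loc_unit_loc.
by move=> hn hm; apply/le_anti; rewrite !aux.
Qed.

(** The default of [xget] is never reached, by [has_val_exists]. *)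
Definition pval p x : \bar int :=
  if x == 0 then +oo%E else (xget 0 (has_val p x))%:E.

Lemma pval0 p : pval p 0 = +oo%E.
Proof. by rewrite /pval eqxx. Qed.

Lemma has_val_neq0 p x n : has_val p x n -> x != 0.
Proof.
by move=> [y uy ->]; rewrite mulf_neq0 ?expfz_neq0 ?(loc_unit_neq0 uy).
Qed.

Lemma has_valE p x n : has_val p x n -> pval p x = n%:E.
Proof.
move=> h; rewrite /pval (negbTE (has_val_neq0 h)); congr EFin.
apply: has_val_inj (h); exact: (@xgetPex int 0 (has_val p x) (ex_intro _ n h)).
Qed.

Lemma pval_fin p x : x != 0 -> exists n, has_val p x n /\ pval p x = n%:E.
Proof. by move=> /(has_val_exists p)[n h]; exists n; split=> //; exact: has_valE. Qed.

Lemma pval_pinfty p x : pval p x = +oo%E -> x = 0.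
Proof.
move=> v; apply/eqP/negPn/negP => /(pval_fin p)[n [_]]; by rewrite v.
Qed.

Lemma pval_gtNy p x : (-oo < pval p x)%E.
Proof. by rewrite /pval; case: ifP => // _; rewrite ltNyr. Qed.

Lemma le_pval p x m :
  (m%:E <= pval p x)%E <-> exists2 t, localization p t & x = unif p ^ m * t.
Proof.
have [->|x0] := eqVneq x 0.
  rewrite pval0 leey; split=> // _; exists 0; last by rewrite mulr0.
  by rewrite -tofrac0; apply: localization_base.
by have [n [h ->]] := pval_fin p x0; rewrite lee_fin; apply: iff_sym; apply: has_val_ge.
Qed.

Lemma pvalM p x y : pval p (x * y) = (pval p x + pval p y)%E.
Proof.
have [->|x0] := eqVneq x 0.
  by rewrite mul0r pval0 addye // gt_eqF // pval_gtNy.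
have [->|y0] := eqVneq y 0.
  by rewrite mulr0 pval0 addey // gt_eqF // pval_gtNy.
have [n [[z uz ->] ->]] := pval_fin p x0; have [m [[t ut ->] ->]] := pval_fin p y0.
rewrite -EFinD; apply: has_valE; exists (z * t); first exact: loc_unitM.
by rewrite expfzDr // mulrACA.
Qed.

Lemma pval_unifX p n : pval p (unif p ^ n) = n%:E.
Proof.
apply: has_valE; exists 1; last by rewrite mulr1.
by rewrite -tofrac1; apply: loc_unit_base; exact: Max1.
Qed.

Lemma pval_unit p a : ~ max_set p a -> pval p a%:F = 0%E.
Proof.
by move=> pa; apply: has_valE; exists a%:F; rewrite ?mul1r //; apply: loc_unit_base.
Qed.

Lemma locE p x : localization p x <-> (0 <= pval p x)%E.
Proof.
rewrite -[0%E]/(0%:E) le_pval; split=> [lx|[t lt ->]]; last by rewrite mul1r.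
by exists x => //; rewrite mul1r.
Qed.

Lemma pval_base p a : (0 <= pval p a%:F)%E.
Proof. by apply/locE/localization_base. Qed.

Lemma pval_Max p a : max_set p a -> (1 <= pval p a%:F)%E.
Proof.
move=> /Max_unif[d ->]; rewrite pvalM -[unif p]expr1z pval_unifX.
by rewrite leeDl // pval_base.
Qed.

(** The ultrametric inequality in threshold form: [unif p ^ n] times the local ring is closed under
    addition. *)
Lemma pval_add p x y (n : \bar int) : (n <= pval p x)%E -> (n <= pval p y)%E ->
  (n <= pval p (x + y)%R)%E.
Proof.
case: n => [n| |]; last by rewrite !leNye.
- move=> /le_pval[t lt ->] /le_pval[s ls ->]; apply/le_pval.
  by exists (t + s); [exact: locD|rewrite mulrDr].
- by rewrite !leye_eq => /eqP/pval_pinfty -> /eqP/pval_pinfty ->; rewrite addr0 pval0.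
Qed.

Lemma submodule_pval p (n : \bar int) : submodule [set x | (n <= pval p x)%E].
Proof.
split=> /=; first by rewrite pval0 leey.
- by move=> x y; apply: pval_add.
- move=> a x nx; rewrite pvalM (le_trans nx) // leeDr //; exact: pval_base.
Qed.

Lemma pval_mul p x y (m n : int) : (m%:E <= pval p x)%E -> (n%:E <= pval p y)%E ->
  ((m + n)%:E <= pval p (x * y)%R)%E.
Proof. by move=> mx ny; rewrite pvalM EFinD leeD. Qed.

Lemma pval_MaxX p (n : nat) (a : D) :
  max_set p a -> (n%:Z%:E <= pval p (a ^+ n)%:F)%E.
Proof.
move=> pa; elim: n => [|n IH]; first exact: pval_base.
rewrite exprS tofracM -[n.+1]add1n PoszD.
by apply: pval_mul IH; exact: pval_Max.
Qed.

Lemma ideal_pow_pval p n x : ideal_pow p n x -> (n%:Z%:E <= pval p x)%E.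
Proof.
elim: n x => [|n IH] x /=; first by case=> a _ <-; exact: pval_base.
apply: (@setprod_sub _ _ _ [set x | (_ <= pval p x)%E]); first exact: submodule_pval.
by move=> _ y [a pa <-] /IH ny /=; rewrite -add1n PoszD pval_mul // pval_Max.
Qed.

Lemma ideal_pow_unif p n :
  exists2 s, ~ max_set p s & ideal_pow p n (unif p ^+ n * s%:F).
Proof.
have [c pc [u pu e]] := unif_spec p.
exists (u ^+ n); first exact: Max_notX.
by rewrite tofracXn -exprMn e -tofracXn; apply: ideal_powX.
Qed.

(** Each factor [(unif p)^-1] carries one factor from [p] into [D]. *)
Lemma inv_ideal_pow_unif p n : colon (@base D) (ideal_pow p n) (unif p ^- n).
Proof.
elim: n => [|n IH] x /=; first by rewrite invr1 mul1r.
rewrite mulrC.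
pose C : set K := [set x | base (x * unif p ^- n.+1)].
have CS : submodule C.
  have [b0 bD bZ] := submodule_base D.
  split; rewrite /C /=; first by rewrite mul0r.
  - by move=> y z By Bz; rewrite mulrDl; apply: bD.
  - by move=> a y By; rewrite -mulrA; apply: bZ.
move: x; apply: (setprod_sub CS) => _ y [a pa <-] py.
rewrite /C /= exprS invfM mulrACA.
have [d e] := unifV_base pa; rewrite [_ * _^-1]mulrC e.
have [_ _] := submodule_base D; apply; rewrite mulrC; exact: IH.
Qed.

(** Powers of [p] have values at least the exponent; conversely [ideal_pow_unif] and
    [inv_ideal_pow_unif] place the powers of [unif p] in these modules, up to elements invertible at
    [p]. *)
Lemma prime_pow_locE p (n : \bar int) :
  prime_pow_loc p n = [set x | (n <= pval p x)%E].
Proof.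
apply/seteqP; split=> x /=; case: n => [[n|n]| |] /=.
- apply: (@setprod_sub _ _ _ [set x | (_ <= pval p x)%E]); first exact: submodule_pval.
  move=> a t /ideal_pow_pval na /locE t0 /=.
  by rewrite -[n%:Z]addr0 pval_mul.
- apply: (@setprod_sub _ _ _ [set x | (_ <= pval p x)%E]); first exact: submodule_pval.
  move=> a t ca /locE t0 /=; rewrite -[Negz n]addr0 pval_mul //.
  (* [Negz n] is [-(n+1)]: testing [a] on an element of value exactly [n+1] bounds its own value
     from below. *)
  have [s ps sn] := ideal_pow_unif p n.+1.
  have [d _ e] := ca _ sn; have := pval_base p d.
  rewrite e pvalM pvalM pval_unit // adde0 exprnP pval_unifX NegzE.
  by case: (pval p a) => [k| |] //; rewrite -EFinD !lee_fin; lia.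
- by move=> ->; rewrite pval0.
- by rewrite leNye.
- move=> /le_pval[t lt ->]; have [s ps sn] := ideal_pow_unif p n.
  have -> : unif p ^ n%:Z * t = (unif p ^+ n * s%:F) * (s%:F^-1 * t).
    by rewrite mulrA mulfK // tofrac_eq0 (Max_not_neq0 ps).
  apply: setprodM => //; apply: locM => //; exact: locV.
- move=> /le_pval[t lt ->]; rewrite NegzE -exprnN.
  by apply: setprodM => //; exact: (@inv_ideal_pow_unif p n.+1).
- by rewrite leye_eq => /eqP/pval_pinfty.
- by [].
Qed.

(** A nonzero ideal [I] maximal among those below infinitely many maximal ideals is prime: if
    [y * z] is in [I], every [p] above [I] is above [I + yD] or [I + zD]. So [I] is maximal and lies
    below itself only. *)
Lemma finite_Max (a : D) : a != 0 -> finite_set [set p : Max D | max_set p a].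
Proof.
move=> a0; apply: contrapT => ainf.
pose V (I : set D) := [set p : Max D | I `<=` p].
pose I0 : set D := [set x | exists b, x = b * a].
have I0I : is_ideal I0.
  split; first by exists 0; rewrite mul0r.
  - by move=> _ _ [b ->] [c ->]; exists (b + c); rewrite mulrDl.
  - by move=> c _ [b ->]; exists (c * b); rewrite mulrA.
have [||I [II [x Ix x0] Iinf] Imax] := noetherian_maximal (dedekind_noetherian hD)
  (F := [set I | [/\ is_ideal I, exists2 x, I x & x != 0 & ~ finite_set (V I)]]).
- by move=> I [].
- exists I0; split=> //; first by exists a => //; exists 1; rewrite mul1r.
  apply: contra_not ainf; apply: sub_finite_set => p pa _ [b ->]; exact: MaxMr.
have bigger (y : D) : ~ I y -> finite_set (V (adjoin I y)).
  move=> Iy; apply: contrapT => inf; apply: Iy.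
  have <- : adjoin I y = I.
    apply: Imax; last exact: sub_adjoin.
    split=> //; first exact: is_ideal_adjoin.
    by exists x => //; apply: sub_adjoin.
  exact: mem_adjoin.
have I1 : ~ I 1.
  move=> I1; apply: Iinf; apply: sub_finite_set (finite_set0 _) => p /(_ _ I1).
  exact: Max1.
have : prime_ideal I.
  split=> // y z Iyz; apply: contrapT => /not_orP[Iy Iz]; apply: Iinf.
  apply: (@sub_finite_set _ _ (V (adjoin I y) `|` V (adjoin I z))); last first.
    by rewrite finite_setU; split; apply: bigger.
  have Vadj p t : I `<=` p -> max_set p t -> adjoin I t `<=` p.
    move=> Ip pt _ [i Ii [b ->]]; have [[_ pD _] _ _] := max_setP p.
    by apply: pD; [exact: Ip|exact: MaxMr].
  move=> p Ip; case: (Max_prime p) => _ _ /(_ y z (Ip _ Iyz)) [pt|pt].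
    by left; apply: Vadj.
  by right; apply: Vadj.
case: hD => _ _ /[apply] IM.
have {}IM : maximal_ideal I.
  by apply: IM => I_eq0; move: Ix x0; rewrite I_eq0 /= => ->; rewrite eqxx.
apply: Iinf; apply: (@sub_finite_set _ _ [set MaxIdeal IM]); last exact: finite_set1.
by move=> p Ip /=; apply/esym/Max_sub.
Qed.

Lemma finite_pval x : x != 0 -> finite_set [set p | pval p x <> 0%E].
Proof.
have [a [b b0 xE] a0] := fracP x => /a0 {}a0.
apply: (@sub_finite_set _ _ ([set p : Max D | max_set p a] `|` [set p : Max D | max_set p b])).
  move=> p vp; apply: contrapT => /not_orP[pa pb]; apply: vp.
  by apply: has_valE; exists x; [exists a, b|rewrite mul1r].
by rewrite finite_setU; split; apply: finite_Max.
Qed.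

End Valuation.

Lemma neNy_ge (n : \bar int) : n <> -oo%E -> exists m : int, (- n <= m%:E)%E.
Proof.
case: n => [n| |] // _; first by exists (- n); rewrite lee_fin.
by exists 0; rewrite leNye.
Qed.


(** * Submodules of [K] and their exponent functions *)

Section LocalGlobal.
Variable D : idomainType.
Hypothesis hD : dedekind_domain D.
Hypothesis Dnf : ~ GRing.field_axiom D.
Notation K := {fraction D}.
Notation v := (pval hD Dnf).
Implicit Types (p q : Max D) (x y : K) (f g h : Max D -> \bar int) (I J : kmod D).

Lemma loc_interE f x : loc_inter f x <-> forall p, (- f p <= v p x)%E.
Proof.
split=> [fx p|fx p _]; last by rewrite (prime_pow_locE hD Dnf); apply: fx.
by have := fx p Logic.I; rewrite (prime_pow_locE hD Dnf).
Qed.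

(** Powers of [unif p] take every integer value, and integer thresholds determine an element of
    Z[+-oo]. *)
Lemma prime_pow_loc_sub p (m n : \bar int) :
  prime_pow_loc p m `<=` prime_pow_loc p n -> (n <= m)%E.
Proof.
rewrite !(prime_pow_locE hD Dnf) => mn.
have {}mn (k : int) : (m <= k%:E)%E -> (n <= k%:E)%E.
  by have := mn (unif hD Dnf p ^ k); rewrite /= pval_unifX.
case: m mn => [m| |] mn; [exact: mn|exact: leey|].
case: n mn => [n| |] // mn; last by have := mn 0 (leNye _).
by have := mn (n - 1) (leNye _); rewrite lee_fin; lia.
Qed.

Lemma prime_pow_loc_inj p : injective (prime_pow_loc p).
Proof. by move=> m n mn; apply/le_anti; rewrite !(@prime_pow_loc_sub p) ?mn. Qed.

Lemma vpE p I n : setprod I (localization p) = prime_pow_loc p n -> vp p I = n.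
Proof.
move=> In; apply: (@prime_pow_loc_inj p); rewrite -In; apply/esym.
exact: (@xgetPex (\bar int) 0%E [set n | setprod I (localization p) = prime_pow_loc p n]
  (ex_intro _ n In)).
Qed.

Lemma setprod_pval_ge (A : set K) p (n : \bar int) :
  (forall x, A x -> (n <= v p x)%E) ->
  setprod A (localization p) `<=` [set x | (n <= v p x)%E].
Proof.
move=> An; apply: setprod_sub; first exact: submodule_pval.
move=> x t /An nx /(locE hD Dnf) t0 /=.
by rewrite pvalM (le_trans nx) // leeDl.
Qed.

Lemma mem_setprod_loc (A : set K) p x y : A x -> x != 0 -> (v p x <= v p y)%E ->
  setprod A (localization p) y.
Proof.
move=> Ax x0 xy; rewrite -[y](mulVKf x0); apply: setprodM => //.
apply/(locE hD Dnf); move: xy; rewrite -{1}[y](mulVKf x0) pvalM.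
have [n [_ ->]] := pval_fin hD Dnf p x0.
by case: (v p _) => [k| |] //; rewrite -EFinD !lee_fin; lia.
Qed.

(** The exponent is the least value on [I] if the values are bounded below. Otherwise every [y] is a
    local multiple of some [x] in [I] of smaller value, and the exponent is [-oo]. *)
Lemma setprod_locE p I : exists n, setprod I (localization p) = prime_pow_loc p n.
Proof.
have [x0 Ix0 x00] := kmod_neq0 I.
have [[m mI]|unbounded] :=
  pselect (exists m : int, forall x, kmod_set I x -> (m%:E <= v p x)%E).
  (* Counted from the bound [m], finite values are naturals, so a least one exists. *)
  have kE x : kmod_set I x -> x != 0 -> exists k : nat, v p x = (m + k%:Z)%:E.
    move=> Ix xn0; have [n [_ nE]] := pval_fin hD Dnf p xn0.
    have := mI _ Ix; rewrite nE lee_fin => mn; exists `|n - m|%N; congr EFin; lia.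
  have [k0 k0E] := kE _ Ix0 x00.
  pose P k := `[< exists2 x, kmod_set I x & v p x = (m + k%:Z)%:E >].
  have [|k /asboolP[x Ix xk] kmin] := @ex_minnP P.
    by exists k0; apply/asboolP; exists x0.
  exists (m + k%:Z)%:E; rewrite (prime_pow_locE hD Dnf).
  apply/seteqP; split.
    apply: setprod_pval_ge => y Iy.
    have [->|y0] := eqVneq y 0; first by rewrite pval0 leey.
    have [l lE] := kE _ Iy y0; rewrite lE lee_fin lerD2l lez_nat.
    by apply: kmin; apply/asboolP; exists y.
  move=> y /=; rewrite -xk; apply: mem_setprod_loc => //.
  by apply/eqP => x0'; rewrite x0' pval0 in xk.
exists -oo%E; rewrite /=; apply/seteqP; split=> // y _.
have [->|y0] := eqVneq y 0; first exact: setprod0.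
have [n [_ nE]] := pval_fin hD Dnf p y0.
have [x Ix xn] : exists2 x, kmod_set I x & ~ (n%:E <= v p x)%E.
  apply: contrapT => h; apply: unbounded; exists n => x Ix.
  by apply: contrapT => h'; apply: h; exists x.
apply: (mem_setprod_loc Ix).
  by apply/eqP => x0'; apply: xn; rewrite x0' pval0 leey.
by rewrite nE; move/negP: xn; rewrite -ltNge => /ltW.
Qed.

Lemma vp_spec p I : setprod I (localization p) = prime_pow_loc p (vp p I).
Proof. by have [n In] := setprod_locE p I; rewrite (vpE In). Qed.

Lemma kmod_val_ge I x p : kmod_set I x -> (vp p I <= v p x)%E.
Proof.
move=> Ix; have : setprod I (localization p) x.
  by rewrite -[x]mulr1; apply: setprodM => //; exact: loc1.
by rewrite vp_spec (prime_pow_locE hD Dnf).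
Qed.

(** The denominators of a finite sum have a common multiple outside [p]. *)
Lemma setprod_loc_clear I p x : setprod I (localization p) x ->
  exists2 s, ~ max_set p s & kmod_set I (s%:F * x).
Proof.
have [I0 ID IZ] := kmod_submod I.
apply: (@setprod_sub _ _ _ [set x | exists2 s, ~ max_set p s & kmod_set I (s%:F * x)]).
  split.
  - by exists 1; [exact: Max1|rewrite mulr0].
  - move=> y z [s ps Is] [t pt It]; exists (t * s); first exact: Max_notM.
    rewrite mulrDr; apply: ID; first by rewrite tofracM -mulrA; apply: IZ.
    by rewrite [t * s]mulrC tofracM -mulrA; apply: IZ.
  - by move=> a y [s ps Is]; exists s => //; rewrite mulrCA; apply: IZ.
move=> y _ Iy [a [s [ps ->]]]; exists s => //.
rewrite mulrCA [s%:F * _]mulrC divfK ?tofrac_eq0 ?(Max_not_neq0 ps) //.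
by rewrite mulrC; apply: IZ.
Qed.

(** Local-global principle: the ideal of denominators carrying [x] into [I] lies in no maximal
    ideal, hence contains 1. *)
Lemma kmodE I : kmod_set I = loc_inter (fun p => - vp p I)%E.
Proof.
apply/seteqP; split=> x.
  by move=> Ix; apply/loc_interE => p; rewrite oppeK; exact: kmod_val_ge.
move=> /loc_interE Ix.
have [I0 ID IZ] := kmod_submod I.
pose den : set D := [set a | kmod_set I (a%:F * x)].
have denI : is_ideal den.
  rewrite /den; split => /=; first by rewrite tofrac0 mul0r.
  - by move=> a b Ia Ib; rewrite tofracD mulrDl; apply: ID.
  - by move=> a b Ib; rewrite tofracM -mulrA; apply: IZ.
suff : den 1 by rewrite /den /= tofrac1 mul1r.
apply: contrapT => /(ideal_in_Max (dedekind_noetherian hD) denI)[p denp].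
have [s ps Is] : exists2 s, ~ max_set p s & kmod_set I (s%:F * x).
  apply: setprod_loc_clear; rewrite vp_spec (prime_pow_locE hD Dnf) /=.
  by have := Ix p; rewrite oppeK.
exact/ps/denp.
Qed.

(** A nonzero [x] in [I] bounds the exponents above by its own values, which are finite and almost
    all zero. *)
Lemma zfun_vp I : zfun (Max D) (fun p => - vp p I)%E.
Proof.
have [x Ix x0] := kmod_neq0 I; split=> [p vpy|].
  have := kmod_val_ge p Ix; have [n [_ ->]] := pval_fin hD Dnf p x0.
  by case: (vp p I) vpy.
apply: sub_finite_set (finite_pval hD Dnf x0) => p /=.
rewrite oppe_lt0 => vp0; apply/eqP; rewrite gt_eqF //.
exact: lt_le_trans vp0 (kmod_val_ge p Ix).
Qed.

(** Multiplying one choice of [t] for each member of [B] meets all conditions at once and stays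
    outside the prime [p]. *)
Lemma exists_notin_Max (B : set (Max D)) p (P : Max D -> set D) :
  finite_set B -> (forall q a b, P q a -> P q (a * b)) ->
  (forall q, B q -> exists2 t, ~ max_set p t & P q t) ->
  exists2 t, ~ max_set p t & forall q, B q -> P q t.
Proof.
move=> /(@finite_seqP {classic Max D})[s ->] PM.
elim: s => [|q s IH] h; first by exists 1; [exact: Max1|].
have [|t pt tP] := IH; first by move=> r rs; apply: h; rewrite /= inE rs orbT.
have [|u pu uP] := h q; first by rewrite /= inE eqxx.
exists (u * t) => [|r]; first exact: Max_notM.
rewrite /= inE => /orP[/eqP ->|rs]; first exact: PM.
by rewrite mulrC; apply/PM/tP.
Qed.

(** Only finitely many [q] violate the bound, and [p] is not among them. At each, a power of an
    element of [q] outside [p] repairs it. *)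
Lemma loc_inter_approx f x p : zfun _ f -> (- f p <= v p x)%E ->
  exists2 s, ~ max_set p s & loc_inter f (s%:F * x).
Proof.
move=> [fNy ffin] fx.
have [->|x0] := eqVneq x 0.
  by exists 1; [exact: Max1|apply/loc_interE => q; rewrite mulr0 pval0 leey].
pose B := [set q | ~ (- f q <= v q x)%E].
have Bfin : finite_set B.
  apply: (@sub_finite_set _ _ ([set q | (f q < 0)%E] `|` [set q | v q x <> 0%E])).
    move=> q Bq; apply: contrapT => /not_orP[/negP fq /contrapT vq]; apply: Bq.
    by rewrite vq leeNl oppe0 leNgt.
  by rewrite finite_setU; split=> //; apply: finite_pval.
have [|q Bq|s ps sP] :=
    @exists_notin_Max B p (fun q => [set t | (- f q <= v q (t%:F * x)%R)%E]) Bfin.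
- move=> q a b /= /le_trans; apply.
  have -> : (a * b)%:F * x = a%:F * x * b%:F by rewrite tofracM; ring.
  by rewrite (pvalM hD Dnf q (a%:F * x)); apply/leeDl/pval_base.
- have [t qt pt] : exists2 t, max_set q t & ~ max_set p t.
    by apply: Max_sep => pq; apply: Bq; rewrite -pq.
  have [n [_ nE]] := pval_fin hD Dnf q x0.
  have [m mE] := neNy_ge (fNy q).
  (* The new value is at least [|m - n| + n], hence at least [m]. *)
  exists (t ^+ (absz (m - n)%R)); first exact: Max_notX.
  apply: le_trans mE _.
  have nx : (n%:E <= v q x)%E by rewrite nE.
  apply: le_trans (pval_mul (pval_MaxX hD Dnf (absz (m - n)%R) qt) nx).
  by rewrite lee_fin; lia.
exists s => //; apply/loc_interE => q.
have [Bq|/contrapT h] := pselect (B q); first exact: sP.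
by rewrite pvalM; apply: le_trans h _; apply/leeDr/pval_base.
Qed.

Lemma loc_inter_attained f p (m : int) : zfun _ f -> (- f p <= m%:E)%E ->
  exists2 x, loc_inter f x & v p x = m%:E.
Proof.
move=> fZ; rewrite -(pval_unifX hD Dnf p m) => /(loc_inter_approx fZ)[s ps sx].
by exists (s%:F * unif hD Dnf p ^ m); rewrite // pvalM pval_unit ?add0e.
Qed.

(** The conditions at the other maximal ideals lose nothing at [p]: [loc_inter_approx] meets them
    after multiplication by some [s] invertible at [p]. *)
Lemma vp_loc_inter f (fZ : zfun _ f) p : vp p (loc_inter_mod Dnf fZ) = (- f p)%E.
Proof.
apply: vpE; rewrite (prime_pow_locE hD Dnf); apply/seteqP; split.
  by apply: setprod_pval_ge => x /loc_interE.
move=> x /= /(loc_inter_approx fZ)[s ps sx].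
have -> : x = (s%:F * x) * s%:F^-1.
  by rewrite mulrC mulKf // tofrac_eq0 (Max_not_neq0 ps).
by apply: setprodM => //; exact: locV.
Qed.

Lemma loc_inter_le f g : zfun _ f -> zfun _ g ->
  loc_inter f `<=` loc_inter g <-> forall p, (f p <= g p)%E.
Proof.
move=> fZ gZ; split=> [fg p|fg x /loc_interE fx]; last first.
  by apply/loc_interE => p; apply: le_trans (fx p); rewrite leeN2.
rewrite -leeN2; apply: (@prime_pow_loc_sub p).
rewrite -(vp_loc_inter fZ) -(vp_loc_inter gZ) -!vp_spec.
move=> _ [n [a [b [fa lb ->]]]]; exists n, a, b; split=> // i; exact/fg/fa.
Qed.

(* Exponents of the colon module: f - h, with oo - h = oo for every h. *)
Definition subf f h p : \bar int :=
  match f p, h p with m%:E%E, n%:E%E => (m - n)%:E%E | _, _ => +oo%E end.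

(** Where both exponents are finite, the value [- h p] is attained, which forces the bound on [x].
    The last hypothesis excludes [h p = +oo] with [f p] finite, where the colon is zero but [subf]
    is [+oo]. *)
Lemma colon_loc_inter f h : zfun _ f -> zfun _ h ->
  (forall p, h p = +oo%E -> f p = +oo%E) ->
  colon (loc_inter f) (loc_inter h) = loc_inter (subf f h).
Proof.
move=> [fNy _] hZ hf; have [hNy _] := hZ; apply/seteqP; split=> x.
  move=> xhf; apply/loc_interE => p; rewrite /subf.
  case fp: (f p) (fNy p) => [n| |] // _; last exact: leNye.
  case hp: (h p) (hNy p) (hf p) => [m| |] // _; last by rewrite fp => /(_ erefl).
  have [|y hy ym] := @loc_inter_attained h p (- m) hZ; first by rewrite hp.
  have /loc_interE/(_ p) := xhf y hy; rewrite pvalM ym fp.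
  case: (v p x) => [k| |] //; last by move=> *; exact: leey.
  by rewrite -EFinD !lee_fin => + _; lia.
move=> /loc_interE xfh y /loc_interE hy; apply/loc_interE => p.
have := xfh p; rewrite /subf.
case fp: (f p) (fNy p) => [n| |] // _; last by move=> _; exact: leNye.
case hp: (h p) (hNy p) (hf p) => [m| |] // _; last by rewrite fp => /(_ erefl).
move=> _ nx; have := hy p; rewrite hp => my.
apply: le_trans (pval_mul nx my); rewrite lee_fin; lia.
Qed.

(** Take [h = f - g]: it is negative only where [g <= f] fails, and [f - (f - g) = g], both sides
    being [+oo] where [f] is. *)
Lemma preceq_colon f g : zfun _ f -> zfun _ g -> preceq g f ->
  exists2 h, zfun _ h & colon (loc_inter f) (loc_inter h) = loc_inter g.
Proof.
move=> fZ gZ [gf_fin gf_oo]; have [fNy _] := fZ; have [gNy _] := gZ.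
have hZ : zfun _ (subf f g).
  split=> [p|]; first by rewrite /subf; case: (f p); case: (g p).
  apply: sub_finite_set gf_fin => p /=; rewrite /subf.
  case: (f p) => [m| |] //; case: (g p) => [n| |] //.
  by rewrite lte_fin lee_fin => + ?; lia.
exists (subf f g) => //; rewrite colon_loc_inter //.
  congr loc_inter; apply/funext => p; rewrite /subf.
  have := fNy p; have := gNy p; have := gf_oo p.
  case: (f p) => [m| |] //; case: (g p) => [n| |] // gf _ _.
  - by congr EFin; lia.
  - by case: gf => _ /(_ erefl).
move=> p; have := fNy p; have := gNy p; have := gf_oo p; rewrite /subf.
case: (f p) => [m| |] //; case: (g p) => [n| |] // [gf fg] //.
Qed.

(** Here [g = f - h] with [h] the exponents of [I]. The nonzero [x] forces [f] to be [+oo] wherever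
    [h] is, and [g] to be negative only where [x] has positive value; [g <= f] fails only where [h]
    is negative. *)
Lemma colon_preceq f I x : zfun _ f -> colon (loc_inter f) I x -> x != 0 ->
  exists g, [/\ zfun _ g, preceq g f & colon (loc_inter f) I = loc_inter g].
Proof.
move=> fZ xfI x0; have [fNy _] := fZ; have hZ := zfun_vp I.
have IE := kmodE I; move: hZ IE; set h := (fun p => - vp p I)%E => hZ IE.
have [hNy hfin] := hZ.
have hf p : h p = +oo%E -> f p = +oo%E.
  move=> hp; case fp: (f p) (fNy p) => [n| |] // _.
  have [m [_ mE]] := pval_fin hD Dnf p x0.
  (* This makes the value of [x * y] equal to [- n - 1], one below the bound [- f p]. *)
  have [|y hy ym] := @loc_inter_attained h p (- n - m - 1) hZ.
    by rewrite hp leNye.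
  have : loc_inter f (x * y) by apply: xfI; rewrite IE.
  by move=> /loc_interE/(_ p); rewrite pvalM mE ym fp -EFinN -EFinD lee_fin; lia.
move: xfI; rewrite IE colon_loc_inter // => /loc_interE xfh.
exists (subf f h); split=> //; split.
- by move=> p; rewrite /subf; case: (f p); case: (h p).
- apply: sub_finite_set (finite_pval hD Dnf x0) => p /= sp.
  apply/eqP; rewrite gt_eqF //; apply: lt_le_trans (xfh p).
  by rewrite -oppe0 lteN2.
- apply: sub_finite_set hfin => p /=; rewrite /subf.
  have := hf p; case: (f p) (fNy p) => [m| |] // _; case: (h p) (hNy p) => [n| |] // _.
  - by rewrite lee_fin lte_fin => _; lia.
  - by move=> /(_ erefl).
- move=> p; rewrite /subf; have := hf p; have := fNy p.
  case: (f p) => [m| |] //; case: (h p) (hNy p) => [n| |] // _ _.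
Qed.

End LocalGlobal.

(** * Families closed under [preceq] and under infima *)

Section ClosedFamilies.
Variable S : Type.
Implicit Types (f g h : S -> \bar int) (X Y : set (S -> \bar int)).

Lemma pointwise_infP Y g : pointwise_inf Y g <->
  (forall f, Y f -> forall x, (g x <= f x)%E) /\
  (forall x c, (forall f, Y f -> (c <= f x)%E) -> (c <= g x)%E).
Proof.
split=> [gY|[lb glb] x].
  split=> [f Yf x|x c cY]; first by have [lb _] := gY x; apply: lb; exists f.
  by have [_] := gY x; apply=> _ [f Yf <-]; exact: cY.
split=> [_ [f Yf <-]|c cY]; first exact: lb.
by apply: glb => f Yf; apply: cY; exists f.
Qed.

Lemma preceq_refl f : preceq f f.
Proof.
split=> //; apply: sub_finite_set (finite_set0 _) => x /=; by rewrite lexx.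
Qed.

Lemma preceq_trans g f h : preceq f g -> preceq g h -> preceq f h.
Proof.
move=> [fg_fin fg] [gh_fin gh]; split=> [|x]; last by rewrite fg.
apply: (@sub_finite_set _ _
  ([set x | ~ (f x <= g x)%E] `|` [set x | ~ (g x <= h x)%E])).
  move=> x fh; apply: contrapT => /not_orP[/contrapT fgx /contrapT ghx].
  by apply: fh; apply: le_trans ghx.
by rewrite finite_setU.
Qed.

Lemma sub_preceq_closure X : X `<=` zfun S -> X `<=` preceq_closure X.
Proof. by move=> XZ f Xf; split; [exact: XZ|exists f => //; exact: preceq_refl]. Qed.

Lemma sub_inf_closure X : X `<=` zfun S -> X `<=` inf_closure X.
Proof.
move=> XZ f Xf; split; first exact: XZ.
exists [set f]; first by move=> _ ->.
by apply/pointwise_infP; split=> [_ -> //|x c]; apply.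
Qed.

Lemma inf_closureS X Y : X `<=` Y -> inf_closure X `<=` inf_closure Y.
Proof.
by move=> XY g [gZ [W WX Wg]]; split=> //; exists W => //; apply: subset_trans XY.
Qed.

(** Taking all members of [X] above [g] avoids choosing a family for each member of [W]. *)
Lemma inf_closure_idem X : inf_closure (inf_closure X) `<=` inf_closure X.
Proof.
move=> g [gZ [W WX /pointwise_infP[lbW glbW]]]; split=> //.
exists [set f | X f /\ forall x, (g x <= f x)%E]; first by move=> f [].
apply/pointwise_infP; split=> [f [] //|x c cX].
apply: glbW => w Ww; have [_ [Y YX /pointwise_infP[lbY glbY]]] := WX w Ww.
apply: glbY => f Yf; apply: cX; split=> [|y]; first exact: YX.
exact: le_trans (lbW _ Ww _) (lbY _ Yf _).
Qed.

(* If h = inf Y and g precedes h, then g is the infimum of the functions that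
   are oo where f is and g elsewhere, with f in Y. *)
Lemma preceq_dagger X : preceq_closure (dagger X) `<=` dagger X.
Proof.
move=> g [gZ [h [hZ [Y YX /pointwise_infP[lbY glbY]]] [gh_fin gh]]].
pose cut f x := if f x == +oo%E then +oo%E else g x.
have gcut f x : (g x <= cut f x)%E by rewrite /cut; case: ifP; rewrite ?leey.
split=> //; exists [set cut f | f in Y]; last first.
  apply/pointwise_infP; split=> [_ [f Yf <-] x|x c cY]; first exact: gcut.
  have [/gh hx|gx] := pselect (g x = +oo%E).
    by rewrite (gh x).2 ?leey // -hx.
  (* Since [h x] is not [+oo] either, some [f] in [Y] is finite at [x], and [cut f] equals [g]
     there. *)
  have [f Yf fx] : exists2 f, Y f & f x != +oo%E.
    apply: contrapT => noF; apply/gx/gh/eqP; rewrite -leye_eq; apply: glbY => f Yf.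
    rewrite leye_eq; apply: contrapT => /negP fx; apply: noF; by exists f.
  by have := cY _ (ex_intro2 _ _ f Yf erefl); rewrite /cut (negbTE fx).
move=> _ [f Yf <-]; have [fZ [f0 Xf0 ff0]] := YX f Yf; have [gNy gfin] := gZ.
split.
  split=> [x|]; first by rewrite /cut; case: ifP.
  apply: sub_finite_set gfin => x /=; apply: le_lt_trans; exact: gcut.
exists f0 => //; apply: preceq_trans ff0; split.
  apply: sub_finite_set gh_fin => x /= cf ghx; apply: cf; rewrite /cut.
  case: eqP => [->|_]; first exact: lexx.
  exact: le_trans ghx (lbY _ Yf _).
move=> x; rewrite /cut; case: eqP => [->//|fx]; split=> // /gh hx.
by have := lbY _ Yf x; rewrite hx leye_eq => /eqP.
Qed.

(** One round of each closure suffices, because by [preceq_dagger] closing under infima preserves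
    closure under [preceq]. *)
Lemma daggersE : daggers S =
  [set X | [/\ X `<=` zfun S, preceq_closure X `<=` X & inf_closure X `<=` X]].
Proof.
apply/seteqP; split=> [_ [X XZ <-]|X [XZ Xpre Xinf]].
  split; [by move=> f []|exact: preceq_dagger|exact: inf_closure_idem].
exists X => //; apply/seteqP; split.
  by move=> f /(inf_closureS Xpre)/Xinf.
apply: subset_trans (sub_preceq_closure XZ) _.
by apply: sub_inf_closure => f [].
Qed.

End ClosedFamilies.

(** * Semistar operations and their fixed modules *)

Section Main.
Variable D : idomainType.
Hypothesis hD : dedekind_domain D.
Hypothesis Dnf : ~ GRing.field_axiom D.
Implicit Types (s t : semistar D) (I J : kmod D) (f g : Max D -> \bar int).

Let phi I : Max D -> \bar int := fun p => (- vp p I)%E.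

Lemma loc_inter_vp I : loc_inter_mod Dnf (zfun_vp hD Dnf I) = I.
Proof. by apply: kmod_inj; rewrite [RHS](kmodE hD Dnf). Qed.

Lemma oppe_vp_loc_inter f (fZ : zfun _ f) : phi (loc_inter_mod Dnf fZ) = f.
Proof. by apply/funext => p; rewrite /phi (vp_loc_inter hD) oppeK. Qed.

(** By idempotence the range of [s] consists of its fixed points. *)
Lemma semistar_to_funP s f : semistar_to_fun s f <->
  exists fZ : zfun _ f, s (loc_inter_mod Dnf fZ) = loc_inter_mod Dnf fZ.
Proof.
split=> [[_ [I _ <-] <-]|[fZ sf]].
  by exists (zfun_vp hD Dnf (s I)); rewrite !loc_inter_vp star_idem.
exists (loc_inter_mod Dnf fZ); last exact: oppe_vp_loc_inter.
by exists (loc_inter_mod Dnf fZ).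
Qed.

Lemma star_closedP s I : s I = I <-> s I `<=` I.
Proof.
split=> [->//|sI]; apply/kmod_inj/seteqP; split=> //; exact: star_ext.
Qed.

(** For [preceq], write the module [G] of [g] as a colon [(F : H)] with [F] fixed; then [s G * H]
    lies in [s (G * H)], hence in [s F = F]. For infima, an intersection of fixed modules is
    fixed. *)
Lemma semistar_to_fun_closed s : daggers (Max D) (semistar_to_fun s).
Proof.
rewrite daggersE; split.
- by move=> f /semistar_to_funP[].
- move=> g [gZ [f /semistar_to_funP[fZ sf] gf]].
  apply/semistar_to_funP; exists gZ; apply/star_closedP.
  have [h hZ ghE] := preceq_colon hD Dnf fZ gZ gf.
  move=> x sx; suff : loc_inter g x by [].
  rewrite -ghE => y hy.
  have : kmod_set (s (loc_inter_mod Dnf fZ)) (x * y).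
    have : kmod_set (s (kmul (loc_inter_mod Dnf gZ) (loc_inter_mod Dnf hZ))) (x * y).
      by apply: star_mul; apply: setprodM => //; apply: star_ext.
    apply: star_mono => /=; apply: setprod_sub.
      exact: kmod_submod (loc_inter_mod Dnf fZ).
    by move=> a b ga hb; have : loc_inter g a := ga; rewrite -ghE; apply.
  by rewrite sf.
- move=> g [gZ [Y YX /pointwise_infP[lbY glbY]]].
  apply/semistar_to_funP; exists gZ; apply/star_closedP => x sx.
  apply/(loc_interE hD Dnf) => p; rewrite leeNl; apply: glbY => f Yf.
  have [fZ sf] := (semistar_to_funP _ _).1 (YX _ Yf).
  have : kmod_set (s (loc_inter_mod Dnf fZ)) x.
    apply: star_mono sx => /=; apply/(loc_inter_le hD Dnf gZ fZ) => q; exact: lbY.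
  by rewrite sf => /(loc_interE hD Dnf)/(_ p); rewrite leeNl.
Qed.

(** For the converse, [t I] is fixed by [t], hence by [s], and [s I] lies in [s (t I) = t I]. *)
Lemma semistar_to_fun_le s t :
  star_le s t <-> semistar_to_fun t `<=` semistar_to_fun s.
Proof.
split=> [st f /semistar_to_funP[fZ tf]|ts I x sx].
  apply/semistar_to_funP; exists fZ; apply/star_closedP.
  by rewrite -[X in _ `<=` kmod_set X]tf; exact: st.
have : semistar_to_fun s (phi (t I)) by apply: ts; exists (t I) => //; exists I.
move=> /semistar_to_funP[fZ +].
have -> : loc_inter_mod Dnf fZ = t I by apply: kmod_inj; rewrite [RHS](kmodE hD Dnf).
by move=> <-; apply: star_mono sx; exact: star_ext.
Qed.

(** Each [F] from [X] is fixed by its own divisorial closure. Conversely, a fixed [I] is the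
    intersection of the modules [(F : (F : I))]; those with [(F : I)] nonzero have exponents
    preceding a member of [X], and the others are all of [K]. *)
Lemma fun_to_semistarK X : daggers (Max D) X ->
  semistar_to_fun (fun_to_semistar Dnf X) = X.
Proof.
rewrite daggersE => -[XZ Xpre Xinf]; apply/seteqP; split; last first.
  move=> f Xf; have fZ := XZ f Xf.
  apply/semistar_to_funP; exists fZ; apply/star_closedP => x mx.
  have {mx} := mx _ (ex_intro _ f (ex_intro _ fZ (conj Xf erefl))).
  (* 1 lies in [(F : F)], so [(F : (F : F))] is contained in [F]. *)
  move=> /(_ 1); rewrite mulr1; apply=> y; by rewrite mul1r.
move=> k /semistar_to_funP[kZ kE]; apply: Xinf; split=> //.
set I := loc_inter_mod Dnf kZ in kE.
pose Y := [set g | exists f, [/\ X f, zfun _ g, preceq g f &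
  colon (loc_inter f) (colon (loc_inter f) I) = loc_inter g]].
have lbY g : Y g -> forall p, (k p <= g p)%E.
  move=> [f [Xf gZ _ gE]]; apply/(loc_inter_le hD Dnf kZ gZ); rewrite -gE.
  by move=> x Ix y; rewrite mulrC; apply.
exists Y => [g [f [Xf gZ gf _]]|]; first by apply: Xpre; split=> //; exists f.
apply/pointwise_infP; split=> // p c cY.
(* k' is in zfun and below every member of Y, so loc_inter k' `<=` I; comparing
   exponents at p gives c <= k p. *)
pose k' := fun q => if `[< q = p >] then Order.max c (k p) else k q.
have kk' q : (k q <= k' q)%E.
  by rewrite /k'; case: asboolP => [->|//]; rewrite le_max lexx orbT.
have k'Z : zfun _ k'.
  have [kNy kfin] := kZ; split=> [q k'q|].
    by have := kk' q; rewrite k'q leeNy_eq => /eqP; exact: kNy.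
  by apply: sub_finite_set kfin => q; exact: le_lt_trans.
suff : (k' p <= k p)%E.
  by rewrite /k'; case: asboolP => // _; rewrite ge_max => /andP[].
apply: (loc_inter_le hD Dnf k'Z kZ).1 => x k'x.
rewrite -[loc_inter k]/(kmod_set I) -kE => _ [f [fZ [Xf ->]]].
(* If [(F : I)] is zero, its colon in [F] imposes no condition on [x]. *)
have [[a fa a0]|none] :=
  pselect (exists2 a, colon (loc_inter f) I a & a != 0); last first.
  move=> y fy; have -> : y = 0.
    by apply/eqP; apply: contrapT => /negP y0; apply: none; exists y.
  by rewrite mulr0; case: (kmod_submod (loc_inter_mod Dnf fZ)).
pose A := KMod (submodule_colon _ (kmod_submod (loc_inter_mod Dnf fZ)))
               (ex_intro2 _ _ a fa a0).
(* A nonzero element of [I] is a nonzero element of [(F : A)], as [colon_preceq] requires. *)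
have [b Ib b0] := kmod_neq0 I.
have bA : colon (loc_inter f) A b by move=> y; rewrite mulrC; apply.
have [g [gZ gf gE]] := colon_preceq hD Dnf fZ bA b0.
have Yg : Y g by exists f.
suff : colon (loc_inter f) A x by [].
rewrite gE; move: x k'x; apply/(loc_inter_le hD Dnf k'Z gZ) => q.
rewrite /k'; case: asboolP => [->|_]; last exact: lbY.
by rewrite ge_max lbY // cY.
Qed.

End Main.

Theorem corollary3p5 (D : idomainType) (hD : dedekind_domain D)
    (Dnf : ~ GRing.field_axiom D) :
  daggers (Max D) =
    [set X : set (Max D -> \bar int) |
       [/\ X `<=` zfun (Max D), preceq_closure X `<=` X & inf_closure X `<=` X]]
  /\ anti_isomorphism (@star_le D) (@subset (Max D -> \bar int))
       (daggers (Max D)) (@semistar_to_fun D) (fun_to_semistar Dnf).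
Proof.
split; first exact: daggersE.
split.
- exact: semistar_to_fun_closed hD Dnf.
- exact: semistar_to_fun_le hD Dnf.
(* Both operations have the same image by [fun_to_semistarK], and the image determines the order. *)
- move=> s; apply: star_le_anti; apply/(semistar_to_fun_le hD Dnf);
    by rewrite (fun_to_semistarK hD) //; apply: semistar_to_fun_closed.
- exact: fun_to_semistarK hD Dnf.
Qed.
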